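(* Let $q\in\mathbb{C}_p$ with $|1-q|_p<1$, $q\neq1$, let $x\in\mathbb{Z}_p$, $h\in\mathbb{Z}$ and $r\in\mathbb{N}$ ($r\ge1$). Define $E_{n,q}^{(h,-r)}(x)$, $n\ge0$, by the generating function (formal in $t$) $$\frac{1}{2^r}\sum_{m=0}^{\infty}q^{\binom{m}{2}}q^{(h-r)m}\binom{r}{m}_qe^{[m+x]_qt}=\sum_{n=0}^{\infty}E_{n,q}^{(h,-r)}(x)\frac{t^n}{n!}.$$ Then for every integer $n\ge0$, $$E_{n,q}^{(h,-r)}(x)=\frac{1}{2^r(1-q)^n}\sum_{l=0}^n\binom{n}{l}(-1)^lq^{lx}(-q^{h-r+l};q)_r=\frac{1}{2^r}\sum_{m=0}^rq^{\binom{m}{2}}q^{(h-r)m}\binom{r}{m}_q[m+x]_q^n.$$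
   Context: $p$ is a fixed odd prime; $\mathbb{Z}_p$ is the ring of $p$-adic integers, $\mathbb{C}_p$ the completion of an algebraic closure of $\mathbb{Q}_p$, with $|p|_p=1/p$. For $x\in\mathbb{Z}_p$, $q^x=\sum_{k\ge0}\binom{x}{k}(q-1)^k$ and $[x]_q=\frac{1-q^x}{1-q}$. The Gaussian binomial coefficient is $\binom{r}{m}_q=\frac{[r]_q!}{[r-m]_q!\,[m]_q!}$ for $0\le m\le r$, with $[n]_q!=[n]_q\cdots[1]_q$ (a polynomial in $q$, evaluated at the given $q$), and $\binom{r}{m}_q=0$ for $m>r$; in particular the sum in the generating function is finite. $(b;q)_r=\prod_{i=0}^{r-1}(1-bq^i)$. Here $e^{[m+x]_qt}=\sum_{n\ge0}[m+x]_q^n\frac{t^n}{n!}$ as a formal power series in $t$. *)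

(* Defs.v *)
From HB Require Import structures.
From mathcomp Require Import all_boot all_order all_algebra.
From mathcomp Require Import all_classical all_reals.
From mathcomp Require Import topology.

Set Implicit Arguments.
Unset Strict Implicit.
Unset Printing Implicit Defensive.

Import Order.TTheory GRing.Theory Num.Theory.

Local Open Scope classical_set_scope.
Local Open Scope ring_scope.

(* A non-archimedean absolute value cannot be a [normedZmodType] norm, because
   the latter satisfies `|x *+ n| = `|x| *+ n; hence a separate interface. *)
HB.mixin Record isUltrametricField (R : realType) K
    of GRing.Field K & Metric R K := {
  absv : K -> R ;
  mdistE : forall x y : K, mdist x y = absv (x - y) ;
  absvM : forall x y : K, absv (x * y) = absv x * absv y ;
  absvD_le_max : forall x y : K, absv (x + y) <= Num.max (absv x) (absv y)
}.

#[short(type="completeUltrametricFieldType")]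
HB.structure Definition CompleteUltrametricField (R : realType) :=
  { K of GRing.Field K & Metric R K & Complete K & isUltrametricField R K }.

Section Padic.
Context {R : realType} (K : completeUltrametricFieldType R).

(* As K is complete, the closure of Q in K is a completion of Q; when
   absv p = 1/p, the absolute value it carries is the p-adic one. *)
Definition padic_num : set K := closure (range (ratr : rat -> K)).

Definition padic_int : set K := [set x | padic_num x /\ absv x <= 1].

Definition padic_closure : set K :=
  [set a | exists f : {poly K}, [/\ f != 0, forall i, padic_num f`_i & root f a]].

(* C_p is not constructed: it is characterized, up to isometric isomorphism,
   as a complete field in which some algebraic closure of Q_p is dense. *)
Record is_Cp (p : nat) : Prop := IsCp {
  absv_prime : absv (p%:R : K) = p%:R^-1 ;
  padic_closure_algclosed : forall f : {poly K},
    (forall i, padic_closure f`_i) -> (1 < size f)%N -> exists2 a, padic_closure a & root f a ;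
  padic_closure_dense : dense padic_closure
}.

End Padic.

Section QAnalogues.
Context {R : realType} {K : completeUltrametricFieldType R}.
Implicit Types (q x b : K) (h : int) (r m n k : nat).

Definition gbinom x k : K := (\prod_(i < k) (x - i%:R)) / k`!%:R.

Definition qpow q x : K :=
  lim ((\sum_(0 <= k < n) gbinom x k * (q - 1) ^+ k) @[n --> \oo]).

Definition qnum q x : K := (1 - qpow q x) / (1 - q).

(* [n]_X and [n]_X! as polynomials in the indeterminate X. The Gaussian
   binomial has to be evaluated after the (exact) polynomial division, since
   [n]_q may vanish when q is a root of unity. *)
Definition qnum_poly n : {poly K} := (1 - 'X^n) %/ (1 - 'X).

Definition qfact_poly n : {poly K} := \prod_(1 <= i < n.+1) qnum_poly i.

Definition qbinom_poly r m : {poly K} :=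
  if (m <= r)%N then qfact_poly r %/ (qfact_poly (r - m) * qfact_poly m) else 0.

Definition qbinom q r m : K := (qbinom_poly r m).[q].

Definition qpoch b q r : K := \prod_(i < r) (1 - b * q ^+ i).

(* A formal power series in t is represented by its sequence of coefficients;
   [egf u] is the series \sum_n u_n t^n / n!. *)
Definition egf (u : nat -> K) : nat -> K := fun n => u n / n`!%:R.

Definition exp_series (a : K) : nat -> K := egf (fun n => a ^+ n).

(* The sum over all m is taken coefficientwise; it has finite support because
   qbinom q r m = 0 for r < m. *)
Definition gen_series q x h r : nat -> K := fun n =>
  (2 ^+ r)^-1 *
  \sum_(m \in [set: nat])
    (q ^+ 'C(m, 2) * q ^ ((h - r%:Z) * m%:Z) * qbinom q r m *
     exp_series (qnum q (m%:R + x)) n).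

End QAnalogues.

(* Main.v *)
Require Import Defs.
From mathcomp Require Import all_boot all_order all_algebra.
From mathcomp Require Import all_classical all_reals.
From mathcomp Require Import topology.
From mathcomp Require Import ring.
From mathcomp Require normed_module pseudometric_normed_Zmodule sequences.

Import Order.TTheory GRing.Theory Num.Theory.
Import normed_module.numFieldNormedType.Exports.

Local Open Scope classical_set_scope.
Local Open Scope ring_scope.

(** Comparing the coefficients of [t^n] in the generating function gives the
    finite sum over [m] at once, because the Gaussian binomials vanish beyond
    [r] and [n!] is invertible in characteristic zero. What remains is the
    equality of the two finite sums, and it is obtained by summing the same
    double series in two ways. Expand
      [m + x]_q ^ n = (1 - q)^(-n) * (1 - q^m q^x)^n
    by the binomial theorem ([alternating_binomial_sum]); the term of index [l]
    contributes [(q^x)^l * q^(ml)]. For fixed [l], the sum over [m] is then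
    the q-binomial theorem ([q_binomial_theorem]) at [z = q^(h - r + l)], which
    yields the Pochhammer symbol [(-q^(h-r+l); q)_r].

    This argument uses [q^(lx) = (q^x)^l] and [q^(m+x) = q^m q^x], which are
    facts about the p-adic binomial series and form the analytic part of the
    proof. For [x] in [Z_p] the binomials [x choose k] have absolute value at
    most 1 ([absv_gbinom_le1]): they are integers when [x] is a natural number,
    and natural numbers are dense in [Z_p]. Hence the series of [q^x] converges.
    By the Vandermonde identity ([gbinomD]), the product of the
    [n]-th partial sums of [q^x] and [q^y] differs from that of [q^(x+y)] only
    by terms of degree at least [n] in [q - 1], and by the ultrametric
    inequality any sum of such terms is at most [|q - 1|^n]. The exponential
    law [qpowD] follows in the limit.

    Since [q] may be a root of unity, the Gaussian binomials cannot be handled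
    as quotients of values of q-factorials. They are identified, as polynomials,
    with the solution of the q-Pascal recurrence ([qbinom_gauss]), from which
    the q-binomial theorem follows by induction. *)

(** * Ultrametric absolute values *)

Section UltrametricAbsoluteValue.
Context {R : realType} {K : completeUltrametricFieldType R}.
Implicit Types (x y : K) (n : nat).

Lemma absvE x : absv x = mdist x 0.
Proof. by rewrite mdistE subr0. Qed.

Lemma absv_ge0 x : 0 <= absv x.
Proof. by rewrite absvE mdist_ge0. Qed.

Lemma absv0 : absv (0 : K) = 0.
Proof. by rewrite absvE mdistxx. Qed.

Lemma absv_eq0 x : (absv x == 0) = (x == 0).
Proof.
apply/eqP/eqP => [|->]; last exact: absv0.
by rewrite absvE => /mdist_positivity.
Qed.

Lemma absv1 : absv (1 : K) = 1.
Proof.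
have nz : absv (1 : K) != 0 by rewrite absv_eq0 oner_eq0.
by apply: (mulfI nz); rewrite -absvM !mulr1.
Qed.

Lemma absvN x : absv (- x) = absv x.
Proof. by rewrite absvE metric_sym mdistE sub0r opprK. Qed.

Lemma absvX x n : absv (x ^+ n) = absv x ^+ n.
Proof. by elim: n => [|n IH]; rewrite ?expr0 ?absv1// !exprS absvM IH. Qed.

Lemma absvD_le x y (e : R) : absv x <= e -> absv y <= e -> absv (x + y) <= e.
Proof. by move=> xe ye; rewrite (le_trans (absvD_le_max _ _))// ge_max xe ye. Qed.

Lemma absvB_le x y (e : R) : absv x <= e -> absv y <= e -> absv (x - y) <= e.
Proof. by move=> xe ye; rewrite absvD_le// absvN. Qed.

Lemma absvD_lt x y (e : R) : absv x < e -> absv y < e -> absv (x + y) < e.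
Proof. by move=> xe ye; rewrite (le_lt_trans (absvD_le_max _ _))// gt_max xe ye. Qed.

Lemma absvM_le1 x y : absv x <= 1 -> absv y <= 1 -> absv (x * y) <= 1.
Proof. by move=> x1 y1; rewrite absvM mulr_ile1// absv_ge0. Qed.

Lemma absv_sum_le (I : Type) (s : seq I) (P : pred I) (F : I -> K) (e : R) :
  0 <= e -> (forall i, P i -> absv (F i) <= e) ->
  absv (\sum_(i <- s | P i) F i) <= e.
Proof.
move=> e0 Fe; elim/big_ind: _ => //; first by rewrite absv0.
by move=> x y; apply: absvD_le.
Qed.

Lemma absv_natr_le1 n : absv (n%:R : K) <= 1.
Proof.
elim: n => [|n IH]; first by rewrite absv0 ler01.
by rewrite -[n.+1]addn1 natrD absvD_le// absv1.
Qed.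

Lemma absv_intr_le1 (a : int) : absv (a%:~R : K) <= 1.
Proof.
by case: (intP a) => [|n|n]; rewrite ?mulrNz ?absvN ?absv0 ?ler01// absv_natr_le1.
Qed.

Lemma absv_expr_lt x (e : R) : absv x < 1 -> 0 < e ->
  exists n, absv x ^+ n < e.
Proof.
move=> x1 e0; have x0 := absv_ge0 x.
have /sequences.cvg_expr x_to0 : `|absv x| < 1 by rewrite ger0_norm.
have [N _ /(_ N (leqnn N))] :=
  pseudometric_normed_Zmodule.cvgr0_norm_lt _ x_to0 e e0.
by rewrite /= ger0_norm ?exprn_ge0// => xNe; exists N.
Qed.

End UltrametricAbsoluteValue.

(** * Generalized binomial coefficients in characteristic zero *)

Section GeneralizedBinomials.
Context {R : realType} {K : completeUltrametricFieldType R}.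
Hypothesis char0 : forall n, (n.+1%:R : K) != 0.
Implicit Types (x y : K).

Lemma fact_neq0 n : (n`!%:R : K) != 0.
Proof. by rewrite -(prednK (fact_gt0 n)) char0. Qed.

Lemma gbinom_natr a k : gbinom (a%:R : K) k = 'C(a, k)%:R.
Proof.
rewrite /gbinom (_ : \prod_(i < k) _ = (a ^_ k)%:R).
  by rewrite -bin_ffact natrM mulfK// fact_neq0.
elim: k => [|k IH]; first by rewrite big_ord0.
rewrite big_ord_recr /= IH ffactnSr natrM.
case: (leqP k a) => [ka|ak]; first by rewrite natrB.
by rewrite ffact_small// !mul0r.
Qed.

Lemma gbinom0 x : gbinom x 0 = 1.
Proof. by rewrite /gbinom big_ord0 divr1. Qed.

Lemma gbinomS x k : k.+1%:R * gbinom x k.+1 = (x - k%:R) * gbinom x k.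
Proof.
rewrite /gbinom big_ord_recr /= factS natrM invfM.
by move: k.+1%:R (char0 k) k`!%:R^-1 => m m0 f; field.
Qed.

(** The Vandermonde identity, by induction on [n]: with [b] and [c] the binomials
    of [x] and [y], write [n + 1 = i + (n + 1 - i)] in each term of
    [(n + 1) * \sum_i b_i c_(n+1-i)] and lower an index in each half by
    [gbinomS]; the two halves recombine, since
    [(x - i) + (y - (n - i)) = x + y - n]. *)
Lemma gbinomD x y n :
  gbinom (x + y) n = \sum_(0 <= i < n.+1) gbinom x i * gbinom y (n - i).
Proof.
elim: n => [|n IH]; first by rewrite big_nat1 !gbinom0 mulr1.
apply: (mulfI (char0 n)); rewrite gbinomS IH !mulr_sumr.
rewrite [RHS](_ : _ =
    \sum_(0 <= i < n.+2) i%:R * gbinom x i * gbinom y (n.+1 - i) +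
    \sum_(0 <= i < n.+2) gbinom x i * ((n.+1 - i)%N%:R * gbinom y (n.+1 - i))).
  rewrite [X in _ = X + _]big_nat_recl//= !mul0r add0r.
  rewrite [X in _ = _ + X]big_nat_recr//= subnn mul0r mulr0 addr0.
  rewrite -big_split /=; apply: eq_big_nat => i /andP[_ ilt].
  rewrite subSS gbinomS subSn// gbinomS natrB//; ring.
rewrite -big_split /=; apply: eq_big_nat => i /andP[_ ilt].
by rewrite -{1}(subnKC (ltnSE ilt)) natrD; ring.
Qed.

End GeneralizedBinomials.

(** * Binomial coefficients of p-adic integers *)

Section PadicIntegers.
Context {R : realType} {K : completeUltrametricFieldType R} (p : nat).
Hypotheses (p_prime : prime p) (absv_p : absv (p%:R : K) = p%:R^-1).

Lemma absv_p_lt1 : absv (p%:R : K) < 1.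
Proof. by rewrite absv_p invf_lt1 ?ltr1n ?ltr0n ?prime_gt1 ?prime_gt0. Qed.

(** A Bezout relation [u a + v p = 1] would force [|1| < 1] if [|a| < 1]. *)
Lemma absv_intr_coprime (a : int) : coprimez a p -> absv (a%:~R : K) = 1.
Proof.
move=> /coprimezP[[u v] /= uv1]; apply/eqP; rewrite eq_le absv_intr_le1 /=.
rewrite leNgt; apply/negP => a1.
suff : absv (1 : K) < 1 by rewrite absv1 ltxx.
have -> : 1 = u%:~R * a%:~R + v%:~R * p%:R :> K.
  by rewrite -[RHS]/(u%:~R * a%:~R + v%:~R * (p%:Z)%:~R) -!intrM -intrD uv1.
rewrite (le_lt_trans (absvD_le_max _ _))// gt_max.
have small (c : int) (y : K) : absv y < 1 -> absv (c%:~R * y) < 1.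
  move=> y1; rewrite absvM (le_lt_trans _ y1)//.
  by rewrite ler_piMl ?absv_ge0 ?absv_intr_le1.
by rewrite !small ?absv_p_lt1.
Qed.

(** A field in which [|p| = 1/p] has characteristic zero, since both [p] and the
    integers prime to [p] have nonzero absolute value. *)
Lemma padic_natr_neq0 n : (n.+1%:R : K) != 0.
Proof.
have [m pm ->] := pfactor_coprime p_prime (ltn0Sn n).
rewrite natrM natrX mulf_neq0 ?expf_neq0//.
  rewrite -absv_eq0 -[m%:R]/((m%:Z)%:~R) absv_intr_coprime ?oner_neq0//.
  by rewrite coprimezE /= coprime_sym.
by rewrite -absv_eq0 absv_p invr_eq0 pnatr_eq0 -lt0n prime_gt0.
Qed.

Lemma absv_p_expn n : absv ((p ^ n)%N%:R : K) = p%:R^-1 ^+ n.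
Proof. by rewrite natrX absvX absv_p. Qed.

(** If [p] divided the denominator, it would not divide the numerator, and [s]
    would have absolute value at least [p]. *)
Lemma coprimez_denq (s : rat) : absv (ratr s : K) <= 1 -> coprimez (denq s) p.
Proof.
move=> s1; rewrite coprimezE absz_nat coprime_sym prime_coprime//.
apply/negP => pd.
have cop : coprimez (numq s) p.
  by rewrite coprimezE absz_nat (coprime_dvdr pd)// coprime_num_den.
have d0 : (denq s)%:~R != 0 :> K.
  rewrite -absz_denq -(prednK (_ : 0 < `|denq s|)%N) ?absz_gt0 ?denq_eq0//.
  exact: padic_natr_neq0.
have num : ratr s * (denq s)%:~R = (numq s)%:~R :> K by rewrite /ratr mulfVK.
suff : absv ((numq s)%:~R : K) < 1 by rewrite absv_intr_coprime ?ltxx.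
rewrite -num absvM (@le_lt_trans _ _ (absv ((denq s)%:~R : K)))//.
  by rewrite ler_piMl ?absv_ge0.
have /dvdnP[w dw] := pd.
rewrite -absz_denq dw -[(_%:Z)%:~R]/((w * p)%N%:R) natrM absvM.
by rewrite (le_lt_trans _ absv_p_lt1)// ler_piMl ?absv_ge0 ?absv_natr_le1.
Qed.

(** The denominator of [s] is invertible modulo [p^n]; the natural number is the
    residue modulo [p^n] of the numerator times that inverse. *)
Lemma ratr_nat_approx (s : rat) n : absv (ratr s : K) <= 1 ->
  exists a : nat, absv (ratr s - a%:R : K) <= p%:R^-1 ^+ n.
Proof.
move=> /coprimez_denq cop.
have /coprimezP[[u v] /= uv1] : coprimez (denq s) (p ^ n)%N.
  by move: cop; rewrite !coprimezE !absz_nat; apply: coprimeXr.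
pose c := numq s * u.
have pn0 : ((p ^ n)%N : int) != 0 by rewrite eqz_nat -lt0n expn_gt0 prime_gt0.
have cE : c%:~R = (c %/ (p ^ n)%N)%Z%:~R * (p ^ n)%N%:R + (c %% (p ^ n)%N)%Z%:~R :> K.
  by rewrite [in LHS](divz_eq c (p ^ n)%N) intrD intrM.
exists `|(c %% (p ^ n)%N)%Z|%N.
have -> : `|(c %% (p ^ n)%N)%Z|%N%:R = (c%:~R - (c %/ (p ^ n)%N)%Z%:~R * (p ^ n)%N%:R) :> K.
  rewrite -[LHS]/((`|(c %% (p ^ n)%N)%Z|%N%:Z)%:~R) gez0_abs ?modz_ge0//.
  by rewrite cE addrC addKr.
have scale (b : int) : absv (b%:~R * (p ^ n)%N%:R : K) <= p%:R^-1 ^+ n.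
  by rewrite absvM absv_p_expn ler_piMl ?exprn_ge0 ?invr_ge0 ?ler0n ?absv_intr_le1.
rewrite opprB addrCA absvD_le ?scale//.
have d1 : absv ((denq s)%:~R : K) = 1 by apply: absv_intr_coprime.
have d0 : (denq s)%:~R != 0 :> K by rewrite -absv_eq0 d1 oner_eq0.
have -> : absv (ratr s - c%:~R : K) = absv ((ratr s - c%:~R) * (denq s)%:~R : K).
  by rewrite absvM d1 mulr1.
have uv1K : u%:~R * (denq s)%:~R + v%:~R * (p ^ n)%N%:R = 1 :> K.
  by rewrite -[RHS]/(1%:~R) -uv1 intrD !intrM.
have bezout (a b c' d e : K) : b * d + c' * e = 1 -> a - a * b * d = a * c' * e.
  by move=> bd; rewrite -[X in X - _]mulr1 -bd; ring.
by rewrite mulrBl /ratr mulfVK// /c intrM (bezout _ _ _ _ _ uv1K) -intrM.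
Qed.

(** Density of the natural numbers in [Z_p], through rationals of [Z_(p)]: by the
    ultrametric inequality, a rational within distance 1 of [x] is p-integral. *)
Lemma padic_int_nat_approx (x : K) (e : R) : padic_int x -> 0 < e ->
  exists a : nat, absv (x - a%:R) < e.
Proof.
move=> [xcl x1] e0; set d := Num.min e 1.
have d0 : 0 < d by rewrite lt_min e0 ltr01.
have [_ [[s _ <-] sd]] := xcl _ (nbhsx_ballx x d d0).
move: sd; rewrite ballEmdist /= mdistE lt_min => /andP[se s1].
have [n pn] : exists n, (p%:R^-1 : R) ^+ n < e.
  by rewrite -absv_p; apply: absv_expr_lt => //; apply: absv_p_lt1.
have [|a sa] := ratr_nat_approx s n.
  by rewrite -(subKr x (ratr s)) absvB_le// ltW.
by exists a; rewrite -(subrKA (ratr s)) absvD_lt// (le_lt_trans sa).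
Qed.

(** The product [x (x - 1) ... (x - k + 1)] is a 1-Lipschitz function of [x] on
    the unit ball, so it may be compared with its value at a natural number [a]
    such that [|x - a| < |k!|]; that value is [k!] times an integer. *)
Lemma absv_gbinom_le1 (x : K) k : padic_int x -> absv (gbinom x k) <= 1.
Proof.
move=> xint; have x1 : absv x <= 1 by case: xint.
have char0 := padic_natr_neq0.
have f0 : 0 < absv (k`!%:R : K).
  by rewrite lt0r absv_ge0 absv_eq0 (fact_neq0 char0).
have [a xa] := padic_int_nat_approx x _ xint f0.
rewrite /gbinom -[absv _](mulfK (lt0r_neq0 f0)) -absvM mulfVK ?(fact_neq0 char0)//.
rewrite ler_pdivrMr// mul1r.
rewrite -(subrK (\prod_(i < k) (a%:R - i%:R)) (\prod_(i < k) (x - i%:R))).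
apply: absvD_le.
  apply: le_trans (ltW xa); elim: k {f0 xa} => [|k IH].
    by rewrite !big_ord0 subrr absv0 absv_ge0.
  rewrite !big_ord_recr /=.
  set P := \prod_(i < k) _; set Q := \prod_(i < k) _.
  rewrite (_ : _ - _ = (P - Q) * (x - k%:R) + Q * (x - a%:R)); last by ring.
  have Q1 : absv Q <= 1.
    rewrite /Q; elim/big_ind: _ => [|y z|i _]; first by rewrite absv1.
      exact: absvM_le1.
    by rewrite absvB_le ?absv_natr_le1.
  apply: absvD_le; rewrite absvM.
    by rewrite (le_trans _ IH)// ler_piMr ?absv_ge0// absvB_le// absv_natr_le1.
  by rewrite ler_piMl ?absv_ge0.
have -> : \prod_(i < k) (a%:R - i%:R) = 'C(a, k)%:R * k`!%:R :> K.
  by rewrite -(gbinom_natr char0) /gbinom mulfVK// (fact_neq0 char0).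
by rewrite absvM ler_piMl ?absv_ge0 ?absv_natr_le1.
Qed.

End PadicIntegers.

(** * The p-adic power function *)

Lemma triangular_sumE (V : nmodType) (F : nat -> nat -> V) n :
  \sum_(0 <= s < n) \sum_(0 <= i < s.+1) F i (s - i)%N =
  \sum_(0 <= i < n) \sum_(0 <= j < n - i) F i j.
Proof.
elim: n => [|n IH]; first by rewrite !big_nil.
rewrite big_nat_recr //= IH [RHS]big_nat_recr //= subSnn big_nat1.
rewrite [X in _ + X]big_nat_recr //= subnn addrA -big_split /=; congr (_ + _).
by apply: eq_big_nat => i /andP[_ ilt]; rewrite subSn 1?ltnW// big_nat_recr.
Qed.

Section PowersOfQ.
Context {R : realType} {K : completeUltrametricFieldType R}.
Hypothesis char0 : forall n, (n.+1%:R : K) != 0.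
Implicit Types (q x y : K).

(** This is all that the power series [q^x] needs to know about [x]. By
    [absv_gbinom_le1] it holds on [Z_p], and, unlike membership in a closure, it
    is transferred to sums directly by the Vandermonde identity. *)
Definition bounded_gbinom x := forall k, absv (gbinom x k) <= 1.

Lemma bounded_gbinomD x y :
  bounded_gbinom x -> bounded_gbinom y -> bounded_gbinom (x + y).
Proof.
move=> x1 y1 k; rewrite (gbinomD char0) absv_sum_le// => i _.
exact: absvM_le1.
Qed.

Definition qpow_partial q x n : K := \sum_(0 <= k < n) gbinom x k * (q - 1) ^+ k.

Section Convergence.
Variable q : K.
Hypothesis q_near1 : absv (1 - q) < 1.

Let t_lt1 : absv (q - 1) < 1. Proof. by rewrite -absvN opprB. Qed.

Lemma absv_qpow_term_le x n k : bounded_gbinom x -> (n <= k)%N ->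
  absv (gbinom x k * (q - 1) ^+ k) <= absv (q - 1) ^+ n.
Proof.
move=> x1 nk; rewrite absvM absvX.
rewrite (@le_trans _ _ (absv (q - 1) ^+ k))//.
  by rewrite ler_piMl ?exprn_ge0 ?absv_ge0.
by rewrite ler_wiXn2l ?absv_ge0 ?ltW.
Qed.

Lemma qpow_cvg x : bounded_gbinom x ->
  qpow_partial q x n @[n --> \oo] --> qpow q x.
Proof.
move=> x1; apply: cauchy_cvg; apply: cauchy_exP => e e0.
have [N Ne] := absv_expr_lt _ e t_lt1 e0.
exists (qpow_partial q x N); exists N => //= n /= Nn.
rewrite ballEmdist /= mdistE -absvN opprB (le_lt_trans _ Ne)//.
rewrite /qpow_partial (big_cat_nat (leq0n N) Nn)/= addrAC subrr add0r.
rewrite big_nat_cond absv_sum_le ?exprn_ge0 ?absv_ge0// => k /andP[/andP[Nk _] _].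
exact: absv_qpow_term_le.
Qed.

Lemma qpow_unique x (l : K) :
  qpow_partial q x n @[n --> \oo] --> l -> qpow q x = l.
Proof. exact: (@cvg_lim K (@metric_hausdorff _ K) _ _ _ (qpow_partial q x)). Qed.

(** By [gbinomD], the product and the last partial sum have the same terms of
    degree less than [n] in [q - 1]; what is left of the product consists of the
    terms with [i, j < n] and [n <= i + j]. *)
Lemma absv_qpow_partialD x y n : bounded_gbinom x -> bounded_gbinom y ->
  absv (qpow_partial q x n * qpow_partial q y n - qpow_partial q (x + y) n)
  <= absv (q - 1) ^+ n.
Proof.
move=> x1 y1; pose F x k := gbinom x k * (q - 1) ^+ k.
have -> : qpow_partial q (x + y) n =
    \sum_(0 <= i < n) \sum_(0 <= j < n - i) F x i * F y j.
  rewrite -(triangular_sumE _ (fun i j => F x i * F y j)).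
  apply: eq_bigr => s _; rewrite (gbinomD char0) mulr_suml.
  apply: eq_big_nat => i /andP[_ ilt].
  by rewrite /F [RHS]mulrACA -exprD subnKC.
rewrite /qpow_partial mulr_suml -sumrB.
rewrite big_nat_cond absv_sum_le ?exprn_ge0 ?absv_ge0// => i /andP[/andP[_ ilt] _].
rewrite mulr_sumr [X in X - _](big_cat_nat (leq0n (n - i)) (leq_subr i n))/=.
rewrite addrAC subrr add0r.
rewrite big_nat_cond absv_sum_le ?exprn_ge0 ?absv_ge0// => j /andP[/andP[nij _] _].
rewrite /F mulrACA -exprD absvM absvX.
rewrite (@le_trans _ _ (absv (q - 1) ^+ (i + j)))//.
  by rewrite ler_piMl ?exprn_ge0 ?absv_ge0// absvM_le1.
by rewrite ler_wiXn2l ?absv_ge0 ?ltW// -leq_subLR.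
Qed.

Lemma absv_qpow_partial_le1 x n : bounded_gbinom x -> absv (qpow_partial q x n) <= 1.
Proof.
move=> x1; rewrite absv_sum_le// => k _.
exact: (@absv_qpow_term_le x 0 k).
Qed.

Lemma absv_qpow_le1 x : bounded_gbinom x -> absv (qpow q x) <= 1.
Proof.
move=> x1; have /metricType_numDomainType.cvgrPdist_lt/(_ 1 ltr01) := qpow_cvg _ x1.
move=> [n _ /(_ n (leqnn n))] /=; rewrite mdistE => qPn.
rewrite -(subrK (qpow_partial q x n) (qpow q x)) absvD_le ?absv_qpow_partial_le1//.
exact: ltW.
Qed.

Lemma qpowD x y : bounded_gbinom x -> bounded_gbinom y ->
  qpow q (x + y) = qpow q x * qpow q y.
Proof.
move=> x1 y1; apply: qpow_unique.
apply/metricType_numDomainType.cvgrPdist_lt => e e0.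
have [N Ne] := absv_expr_lt _ e t_lt1 e0.
have /metricType_numDomainType.cvgrPdist_lt/(_ e e0) := qpow_cvg _ x1.
have /metricType_numDomainType.cvgrPdist_lt/(_ e e0) := qpow_cvg _ y1.
move=> [Ny _ Hy] [Nx _ Hx]; exists (maxn N (maxn Nx Ny)) => //= n /=.
rewrite !geq_max => /and3P[Nn /Hx + /Hy]; rewrite /= !mdistE => xe ye.
(* The first two terms measure the convergence of each factor, the third one the
   failure of multiplicativity of the partial sums. *)
have -> : qpow q x * qpow q y - qpow_partial q (x + y) n =
  ((qpow q x - qpow_partial q x n) * qpow q y +
   qpow_partial q x n * (qpow q y - qpow_partial q y n)) +
  (qpow_partial q x n * qpow_partial q y n - qpow_partial q (x + y) n) by ring.
apply: absvD_lt; last first.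
  apply: le_lt_trans (absv_qpow_partialD _ _ _ x1 y1) _.
  by apply: le_lt_trans Ne; rewrite ler_wiXn2l ?absv_ge0 ?ltW.
apply: absvD_lt; rewrite absvM.
  by rewrite (le_lt_trans _ xe)// ler_piMr ?absv_ge0 ?absv_qpow_le1.
by rewrite (le_lt_trans _ ye)// ler_piMl ?absv_ge0 ?absv_qpow_partial_le1.
Qed.

Lemma bounded_gbinom_natr m : bounded_gbinom m%:R.
Proof. by move=> k; rewrite (gbinom_natr char0) absv_natr_le1. Qed.

(** For an exponent [m] in [nat] the binomial series is the finite expansion of
    [(1 + (q - 1)) ^ m]. *)
Lemma qpow_natr m : qpow q m%:R = q ^+ m.
Proof.
apply: qpow_unique; apply: cvg_near_cst; exists m.+1 => //= n mn.
rewrite /qpow_partial (big_cat_nat (leq0n m.+1) mn)/=.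
rewrite [X in _ + X]big_nat [X in _ + X]big1 => [|k /andP[mk _]]; last first.
  by rewrite (gbinom_natr char0) bin_small ?mul0r.
rewrite addr0 big_mkord -[in RHS](subrK 1 q) [in RHS]addrC exprDn.
apply: eq_bigr => k _.
by rewrite (gbinom_natr char0) expr1n mul1r mulr_natl.
Qed.

(** Boundedness of the binomials of [l x] is proved along with the identity, as
    [qpowD] requires it at each step. *)
Lemma qpow_natmul l x : bounded_gbinom x -> qpow q (l%:R * x) = qpow q x ^+ l.
Proof.
move=> x1; suff [] : bounded_gbinom (l%:R * x) /\ qpow q (l%:R * x) = qpow q x ^+ l by [].
elim: l => [|l [IHb IH]].
  rewrite mul0r expr0 -[0]/(0%:R); split; first exact: bounded_gbinom_natr.
  by rewrite qpow_natr.
have -> : l.+1%:R * x = x + l%:R * x by rewrite -natr1 mulrDl mul1r addrC.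
by split; [exact: bounded_gbinomD|rewrite qpowD// IH exprS].
Qed.

End Convergence.
End PowersOfQ.

(** * Gaussian binomials and the q-binomial theorem *)

Section GaussianBinomials.
Context {R : realType} {K : completeUltrametricFieldType R}.

(** The Gaussian binomials by their q-Pascal recurrence, which makes sense
    without any division. *)
Fixpoint gauss_poly (r m : nat) : {poly K} :=
  match r, m with
  | _, 0 => 1
  | 0, _.+1 => 0
  | s.+1, k.+1 => gauss_poly s k + 'X^(k.+1) * gauss_poly s k.+1
  end.

Lemma gauss_poly0 r : gauss_poly r 0 = 1.
Proof. by case: r. Qed.

Lemma gauss_poly_small r m : (r < m)%N -> gauss_poly r m = 0.
Proof.
elim: r m => [|r IH] [|m]//= rm.
by rewrite !IH ?mulr0 ?addr0// ltnW.
Qed.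

Lemma one_subX_neq0 : (1 - 'X : {poly K}) != 0.
Proof. by rewrite -oppr_eq0 opprB polyXsubC_eq0. Qed.

Lemma qnum_polyE n : (1 - 'X) * qnum_poly n = 1 - 'X^n :> {poly K}.
Proof.
have geom : 1 - 'X^n = (1 - 'X) * \sum_(i < n) 'X^i :> {poly K}.
  by rewrite -(opprB 'X^n) subrX1 -mulNr opprB.
by rewrite /qnum_poly geom mulKp// one_subX_neq0.
Qed.

Lemma qnum_poly_neq0 n : qnum_poly n.+1 != 0 :> {poly K}.
Proof.
have : (1 - 'X^(n.+1) : {poly K}) != 0.
  by rewrite -oppr_eq0 opprB -size_poly_gt0 size_XnsubC.
by apply: contraNneq => n0; rewrite -qnum_polyE n0 mulr0.
Qed.

Lemma qfact_polyS n : qfact_poly n.+1 = qnum_poly n.+1 * qfact_poly n :> {poly K}.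
Proof. by rewrite /qfact_poly big_nat_recr//= mulrC. Qed.

Lemma qfact_poly_neq0 n : qfact_poly n != 0 :> {poly K}.
Proof.
elim: n => [|n IH]; first by rewrite /qfact_poly big_nil oner_neq0.
by rewrite qfact_polyS mulf_neq0 ?qnum_poly_neq0.
Qed.

Lemma qnum_polyD a b :
  qnum_poly (a + b) = qnum_poly b + 'X^b * qnum_poly a :> {poly K}.
Proof.
apply: (mulfI one_subX_neq0); rewrite mulrDr mulrCA !qnum_polyE exprD; ring.
Qed.

(** The q-Pascal recurrence is compatible with the factorial formula because
    [[a + b] = [b] + X^b [a]] for the q-integers. The induction is on the sum
    [a + b], as the recurrence leads both to [(a - 1, b)] and to [(a, b - 1)]. *)
Lemma gauss_poly_fact a b :
  gauss_poly (a + b) b * (qfact_poly a * qfact_poly b) = qfact_poly (a + b).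
Proof.
have f0 : qfact_poly 0 = 1 :> {poly K} by rewrite /qfact_poly big_nil.
elim: {a b}(a + b)%N {-2}a {-2}b (erefl (a + b)%N) => [|n IH] a b.
  by case: a b => [|a] [|b]// _; rewrite /= f0 !mul1r.
case: b => [|b]; first by rewrite addn0 gauss_poly0 f0 mulr1 mul1r.
rewrite addnS /= => -[abn]; rewrite mulrDl.
case: a abn => [|a] abn.
  rewrite [gauss_poly _ b.+1]gauss_poly_small// mulr0 mul0r addr0 add0n f0 mul1r.
  have := IH 0%N b abn; rewrite !add0n f0 mul1r => IHb.
  by rewrite qfact_polyS mulrCA IHb.
have := IH a.+1 b abn; have := IH a b.+1; rewrite addnS => /(_ abn).
rewrite addSn in abn *; move=> IHl IHr.
rewrite [qfact_poly (a + b).+2]qfact_polyS -addSn -addnS qnum_polyD mulrDl.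
rewrite addSn -{1}IHr -IHl !qfact_polyS; ring.
Qed.

Lemma qbinom_gauss (q : K) r m : qbinom q r m = (gauss_poly r m).[q].
Proof.
rewrite /qbinom /qbinom_poly; case: leqP => [mr|rm]; last by rewrite gauss_poly_small.
by rewrite -{1}(subnK mr) -gauss_poly_fact subnK// mulpK// mulf_neq0 ?qfact_poly_neq0.
Qed.

(** Splitting off the factor [1 + z] and applying the induction hypothesis at
    [z q] produces exactly the two terms of the q-Pascal recurrence, because
    ['C(m+1, 2) = 'C(m, 2) + m]. *)
Lemma q_binomial_theorem (q z : K) r :
  \prod_(i < r) (1 + z * q ^+ i) =
  \sum_(0 <= m < r.+1) q ^+ 'C(m, 2) * qbinom q r m * z ^+ m.
Proof.
elim: r z => [|r IH] z.
  by rewrite big_ord0 big_nat1 qbinom_gauss /= hornerC !expr0 !mulr1.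
rewrite big_ord_recl expr0 mulr1 /=.
under eq_bigr => i _ do rewrite /bump /= add1n exprS mulrA.
rewrite IH mulrDl mul1r mulr_sumr.
rewrite [RHS]big_nat_recl// [X in X + _]big_nat_recl//=.
(* The terms of positive degree that come from the summand 1 of the factor
   [1 + z]; the one of index [r] vanishes and is there to align the two sums. *)
pose F m := q ^+ 'C(m.+1, 2) * q ^+ m.+1 * (gauss_poly r m.+1).[q] * z ^+ m.+1.
have -> : \sum_(0 <= m < r) q ^+ 'C(m.+1, 2) * qbinom q r m.+1 * (z * q) ^+ m.+1 =
    \sum_(0 <= m < r.+1) F m.
  rewrite big_nat_recr//= /F gauss_poly_small// horner0 mulr0 mul0r addr0.
  apply: eq_bigr => m _; rewrite qbinom_gauss exprMn; ring.
rewrite -addrA -big_split /= !qbinom_gauss !gauss_poly0 !expr0; congr (_ + _).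
apply: eq_bigr => m _; rewrite !qbinom_gauss /F /= !hornerE.
rewrite exprMn binS bin1 exprD /= !exprS.
move: (q ^+ _) (q ^+ _) (z ^+ _) (_.[q]) (_.[q]) => a1 a2 a3 a4 a5; ring.
Qed.

End GaussianBinomials.

(** * The two expressions of the Euler numbers *)

Section EulerNumbers.
Context {R : realType} {K : completeUltrametricFieldType R}.
Implicit Types q x : K.

Lemma gen_seriesE q x (h : int) r n :
  gen_series q x h r n = (2 ^+ r)^-1 *
    \sum_(0 <= m < r.+1)
      (q ^+ 'C(m, 2) * q ^ ((h - r%:Z) * m%:Z) * qbinom q r m *
       qnum q (m%:R + x) ^+ n) / n`!%:R.
Proof.
rewrite /gen_series; congr (_ * _).
rewrite -(fsbig_widen `I_r.+1 setT)//=; last first.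
  move=> m [_ /negP]; rewrite -leqNgt => rm /=.
  by rewrite qbinom_gauss gauss_poly_small// horner0 mulr0 !mul0r.
rewrite -fsbig_ord big_mkord; apply: eq_bigr => m _.
by rewrite /exp_series /egf mulrA.
Qed.

Lemma absv_near1_neq0 q : absv (1 - q) < 1 -> q != 0.
Proof. by apply: contraTneq => ->; rewrite subr0 absv1 ltxx. Qed.

Lemma qpoch_binomial q (h : int) (l r : nat) : q != 0 ->
  qpoch (- q ^ (h + l%:Z)) q r =
  \sum_(0 <= m < r.+1)
    q ^+ 'C(m, 2) * q ^ (h * m%:Z) * qbinom q r m * (q ^+ m) ^+ l.
Proof.
move=> q0; rewrite /qpoch.
under eq_bigr => i _ do rewrite mulNr opprK.
rewrite q_binomial_theorem; apply: eq_bigr => m _.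
rewrite expfzDr// exprMn -exprz_exp -!exprnP (exprAC q l m).
by rewrite mulrA; congr (_ * _); rewrite mulrAC.
Qed.

Lemma alternating_binomial_sum (y : K) n :
  \sum_(0 <= l < n.+1) 'C(n, l)%:R * (-1) ^+ l * y ^+ l = (1 - y) ^+ n.
Proof.
rewrite big_mkord exprBn; apply: eq_bigr => l _.
by rewrite expr1n mulr1 -mulrA mulr_natl.
Qed.

End EulerNumbers.

Theorem theorem5 (R : realType) (p : nat) (p_prime : prime p) (p_odd : odd p)
    (Cp : completeUltrametricFieldType R) (CpP : is_Cp Cp p)
    (q : Cp) (q_near1 : absv (1 - q) < 1) (q_neq1 : q != 1)
    (x : Cp) (x_int : padic_int x) (h : int) (r : nat) (r_ge1 : (1 <= r)%N)
    (E : nat -> Cp) (E_def : gen_series q x h r = egf E) (n : nat) :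
  E n = (2 ^+ r * (1 - q) ^+ n)^-1 *
        \sum_(0 <= l < n.+1)
          ('C(n, l)%:R * (-1) ^+ l * qpow q (l%:R * x) *
           qpoch (- q ^ (h - r%:Z + l%:Z)) q r)
  /\
  (2 ^+ r * (1 - q) ^+ n)^-1 *
    \sum_(0 <= l < n.+1)
      ('C(n, l)%:R * (-1) ^+ l * qpow q (l%:R * x) *
       qpoch (- q ^ (h - r%:Z + l%:Z)) q r)
  = (2 ^+ r)^-1 *
    \sum_(0 <= m < r.+1)
      (q ^+ 'C(m, 2) * q ^ ((h - r%:Z) * m%:Z) * qbinom q r m *
       qnum q (m%:R + x) ^+ n).
Proof.
have char0 := padic_natr_neq0 p p_prime (absv_prime CpP).
have x1 : bounded_gbinom x.
  by move=> k; apply: absv_gbinom_le1 p_prime (absv_prime CpP) _ _ x_int.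
set L := _ * \sum_(0 <= l < _) _; set S := _ * \sum_(0 <= m < _) _.
have ES : E n = S.
  have := congr1 (fun u => u n * n`!%:R) E_def.
  rewrite gen_seriesE /egf mulfVK ?(fact_neq0 char0)// => <-.
  rewrite /S -mulrA mulr_suml; congr (_ * _); apply: eq_bigr => m _.
  by rewrite mulfVK ?(fact_neq0 char0).
suff LS : L = S by rewrite LS.
rewrite {ES}/L /S invfM -mulrA; congr (_ * _).
(* The common value: expand the power in one direction, and compute the n-th
   power of the q-number in the other. *)
transitivity ((1 - q) ^- n * \sum_(0 <= m < r.+1)
    q ^+ 'C(m, 2) * q ^ ((h - r%:Z) * m%:Z) * qbinom q r m *
    (1 - q ^+ m * qpow q x) ^+ n).
  congr (_ * _).
  under eq_bigr => l _.
    rewrite qpow_natmul// qpoch_binomial ?absv_near1_neq0// mulr_sumr; over.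
  rewrite exchange_big; apply: eq_bigr => m _ /=.
  rewrite -alternating_binomial_sum mulr_sumr; apply: eq_bigr => l _.
  rewrite exprMn; ring.
rewrite mulr_sumr; apply: eq_bigr => m _.
rewrite mulrCA; congr (_ * _).
rewrite /qnum qpowD//; last exact: bounded_gbinom_natr.
by rewrite qpow_natr// expr_div_n mulrC.
Qed.
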